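(* Let $\{g_\alpha\}_{\alpha\in(0,\alpha_0)}$ be a spectral regularization method and let $\rho\in\mathcal{O}$ be such that $s_\rho\in\mathcal{S}$. Then $\rho$ is strong qualification of $\{g_\alpha\}$ if and only if $0<s_\rho(\lambda)<+\infty$ for every $\lambda>0$.
   Context: Let $\alpha_0\in(0,+\infty]$. A spectral regularization method (SRM) is a family $\{g_\alpha\}_{\alpha\in(0,\alpha_0)}$ of functions $g_\alpha:[0,+\infty)\to\mathbb{R}$ such that: for each $\alpha$, $g_\alpha(\lambda)$ is piecewise continuous in $\lambda\in[0,+\infty)$; there is a constant $C>0$, independent of $\alpha$, with $|\lambda g_\alpha(\lambda)|\le C$ for every $\lambda\in[0,+\infty)$; and $\lim_{\alpha\to0^+}g_\alpha(\lambda)=1/\lambda$ for every $\lambda\in(0,+\infty)$. Put $r_\alpha(\lambda)=1-\lambda g_\alpha(\lambda)$. $\mathcal{O}$ is the set of all non-decreasing functions $\rho:\mathbb{R}^+\to\mathbb{R}^+$ with $\lim_{\alpha\to0^+}\rho(\alpha)=0$. $\mathcal{S}$ is the set of all continuous $s:[0,+\infty)\to[0,+\infty)$ with $s(0)=0$ and $s(\lambda)>0$ for every $\lambda>0$. For $s\in\mathcal{S}$, $\rho\in\mathcal{O}$: $(s,\rho)$ is a weak source-order pair for $\{g_\alpha\}$ if for every $\lambda>0$, $\frac{s(\lambda)|r_\alpha(\lambda)|}{\rho(\alpha)}=O(1)$ as $\alpha\to0^+$; it is a strong source-order pair if moreover $\limsup_{\alpha\to0^+}\frac{s(\lambda)|r_\alpha(\lambda)|}{\rho(\alpha)}>0$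 for every $\lambda>0$. A function $\rho\in\mathcal{O}$ is strong qualification of $\{g_\alpha\}$ if there exists $s\in\mathcal{S}$ such that $(s,\rho)$ is a strong source-order pair for $\{g_\alpha\}$. For $\rho\in\mathcal{O}$ define $s_\rho(\lambda)=\liminf_{\alpha\to0^+}\frac{\rho(\alpha)}{|r_\alpha(\lambda)|}\in[0,+\infty]$ for $\lambda\ge0$, with the convention that the quotient is $+\infty$ when $r_\alpha(\lambda)=0$. *)

(* Defs.v *)
From HB Require Import structures.
From mathcomp Require Import all_boot all_order all_algebra.
From mathcomp Require Import all_classical all_reals all_analysis.

Set Implicit Arguments.
Unset Strict Implicit.
Unset Printing Implicit Defensive.

Import Order.TTheory GRing.Theory Num.Theory.
Import numFieldNormedType.Exports.

Local Open Scope classical_set_scope.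
Local Open Scope ring_scope.

(* Functions defined on [0, +oo[ or ]0, +oo[ are represented by total functions
   on R of which only the values on that domain are constrained. Likewise a
   family (g_a), a in ]0, alpha0[, is a total g : R -> R -> R. *)

Section spectral_regularization.
Context {R : realType}.
Implicit Types (g : R -> R -> R) (s rho f : R -> R).

(* Usual convention on [0, +oo[: every [0, b] has a finite partition such that
   f is continuous on each open piece, with finite one-sided limits at its
   endpoints. The values of f at the partition points are arbitrary. *)
Definition piecewise_continuous f : Prop :=
  forall b : R, 0 < b -> exists2 t : seq R, itv_partition 0 b t &
    forall i, (i < size t)%N ->
      let x := (0 :: t)`_i in let y := t`_i in
      [/\ {in `]x, y[, continuous f}, cvg (f @ x^'+) & cvg (f @ y^'-)].

Definition is_SRM (alpha0 : \bar R) g : Prop :=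
  [/\ forall a : R, 0 < a -> (a%:E < alpha0)%E -> piecewise_continuous (g a),
      exists2 C : R, 0 < C & forall a : R, 0 < a -> (a%:E < alpha0)%E ->
        forall l : R, 0 <= l -> `|l * g a l| <= C
    & forall l : R, 0 < l -> g a l @[a --> 0^'+] --> l^-1].

Definition residual g (a l : R) : R := 1 - l * g a l.

Definition calO rho : Prop :=
  [/\ forall a : R, 0 < a -> 0 < rho a,
      forall a b : R, 0 < a -> a <= b -> rho a <= rho b
    & rho a @[a --> 0^'+] --> 0].

Definition calS s : Prop :=
  [/\ {within `[0, +oo[, continuous s}, s 0 = 0
    & forall l : R, 0 < l -> 0 < s l].

Definition weak_source_order_pair g s rho : Prop :=
  forall l : R, 0 < l ->
    (fun a => s l * `|residual g a l| / rho a) =O_ (0^'+) (fun=> 1 : R).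

Definition strong_source_order_pair g s rho : Prop :=
  weak_source_order_pair g s rho /\
  forall l : R, 0 < l ->
    (0 < limf_esup (fun a => (s l * `|residual g a l| / rho a)%:E) 0^'+)%E.

Definition strong_qualification g rho : Prop :=
  calO rho /\ exists2 s, calS s & strong_source_order_pair g s rho.

Definition s_rho g rho (l : R) : \bar R :=
  limf_einf (fun a => if residual g a l == 0 then +oo%E
                      else (rho a / `|residual g a l|)%:E) 0^'+.

(* A [0, +oo]-valued function belongs to calS when it is finite on [0, +oo[
   and coincides there with an element of calS. *)
Definition calS_ext (sigma : R -> \bar R) : Prop :=
  exists2 s, calS s & forall l : R, 0 <= l -> sigma l = (s l)%:E.

End spectral_regularization.

(* Main.v *)
Require Import Defs.
From mathcomp Require Import all_boot all_order all_algebra.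
From mathcomp Require Import all_classical all_reals all_analysis.
From mathcomp Require Import lra.

Import Order.TTheory GRing.Theory Num.Theory.
Import numFieldNormedType.Exports.

Local Open Scope ring_scope.

(** Both sides follow from [s_rho] belonging to [calS]: the right-hand side is
    then immediate, and [(s_rho, rho)] is itself a strong source-order pair.
    Writing [s = s_rho l] and [q = rho a / |r_a l|], a lower limit equal to the
    positive finite [s] makes [q > s / 2] eventually, so [s / q < 2], and
    [q < 2 s] frequently, so [s / q > 1 / 2]. *)

Section limf_einf_near.
Variables (T : choiceType) (X : filteredType T) (R : realType).
Implicit Types (f : X -> \bar R) (F : set_system X) (x : \bar R).
Local Open Scope ereal_scope.

(** The lower limit is the supremum, over [V] in [F], of the infimum of [f] on [V]; a supremum above
    [x] has one such infimum above [x], and that [V] witnesses the claim. *)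
Lemma limf_einf_gt_near f F x : Filter F ->
  x < limf_einf f F -> \forall y \near F, x < f y.
Proof.
move=> FF; rewrite limf_einfE => /ereal_sup_gt[_ [V FV <-] xV].
near=> y; apply: (lt_le_trans xV); apply: ereal_inf_lbound.
by exists y => //; near: y.
Unshelve. all: by end_near. Qed.

(** The infimum of [f] on any member of [F] is at most the lower limit, hence below [x], so some
    value on that member is below [x]. *)
Lemma limf_einf_lt_frequently f F x (V : set X) :
  limf_einf f F < x -> F V -> exists2 y, V y & f y < x.
Proof.
move=> fx FV.
have : ereal_inf [set f y | y in V]%classic < x.
  apply: le_lt_trans fx; rewrite limf_einfE.
  by apply: ereal_sup_ubound; exists V.
by move=> /ereal_inf_lt[_ [y Vy <-]]; exists y.
Qed.

End limf_einf_near.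

Arguments limf_einf_lt_frequently {T X R f F x V}.

Lemma s_rho_weak_source_order_pair (R : realType) (g : R -> R -> R)
    (s rho : R -> R) :
  (forall a : R, 0 < a -> 0 < rho a) -> (forall l : R, 0 < l -> 0 < s l) ->
  (forall l : R, 0 < l -> s_rho g rho l = (s l)%:E) ->
  weak_source_order_pair g s rho.
Proof.
move=> rho0 s0 srho l l0; apply/eqO_exP; exists 2 => //.
have sl0 := s0 l l0.
have /limf_einf_gt_near sl2 : ((s l / 2)%:E < s_rho g rho l)%E.
  by rewrite srho// lte_fin; lra.
near=> a.
have ra : 0 < rho a by apply: rho0; near: a; exact: nbhs_right_gt.
have : ((s l / 2)%:E < if residual g a l == 0%R then +oo
    else (rho a / `|residual g a l|)%:E)%E by near: a; exact: sl2.
have q0 : 0 <= s l * `|residual g a l| / rho a.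
  by rewrite divr_ge0 ?mulr_ge0 ?(ltW ra) ?(ltW sl0).
rewrite normr1 mulr1 (ger0_norm q0).
(* A vanishing residual gives the quotient [+oo], and the inverse ratio to be bounded is then 0. *)
case: eqP => [-> _|/eqP r0]; first by rewrite normr0 mulr0 mul0r.
rewrite lte_fin ltr_pdivlMr ?normr_gt0// => h.
by rewrite ler_pdivrMr//; lra.
Unshelve. all: by end_near. Qed.

Lemma s_rho_strong_source_order_pair (R : realType) (g : R -> R -> R)
    (s rho : R -> R) :
  (forall a : R, 0 < a -> 0 < rho a) -> (forall l : R, 0 < l -> 0 < s l) ->
  (forall l : R, 0 < l -> s_rho g rho l = (s l)%:E) ->
  strong_source_order_pair g s rho.
Proof.
move=> rho0 s0 srho; split; first exact: s_rho_weak_source_order_pair.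
move=> l l0; have sl0 := s0 l l0.
have sl2 : (s_rho g rho l < (2 * s l)%:E)%E by rewrite srho// lte_fin; lra.
apply: (@lt_le_trans _ _ (2^-1)%:E); first by rewrite lte_fin invr_gt0.
(* The upper limit is an infimum of suprema, so it suffices that each [V] contain a point where the
   ratio is at least 1/2. *)
rewrite limf_esupE; apply: le_ereal_inf_tmp => _ [V FV <-].
(* Intersecting with the positive reals ensures [0 < rho a] at the point found. *)
have FV0 : (0^'+ (V `&` [set a | (0 : R) < a]))%classic.
  by apply: filterI => //; exact: nbhs_right_gt.
have [a [Va a0]] := limf_einf_lt_frequently sl2 FV0.
have ra := rho0 a a0.
(* The residual cannot vanish here: the quotient would be [+oo], not below [2 * s l]. *)
case: eqP => [//|/eqP r0].
rewrite lte_fin ltr_pdivrMr ?normr_gt0// => h.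
apply: le_trans (ereal_sup_ubound _); last by exists a.
by rewrite lee_fin ler_pdivlMr//; lra.
Qed.

Theorem proposition2p1 (R : realType) (alpha0 : \bar R) (g : R -> R -> R)
    (rho : R -> R) (halpha0 : (0 < alpha0)%E) (hg : is_SRM alpha0 g)
    (hrho : calO rho) (hs : calS_ext (s_rho g rho)) :
  strong_qualification g rho <->
  (forall l : R, 0 < l -> (0 < s_rho g rho l < +oo)%E).
Proof.
have [s Ss srho] := hs; have [_ _ s0] := Ss; have [rho0 _ _] := hrho.
split=> [_ l l0|_].
  by rewrite srho ?(ltW l0)// lte_fin s0// ltry.
split=> //; exists s => //; apply: s_rho_strong_source_order_pair => // l l0.
by apply: srho; exact: ltW.
Qed.
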